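(* Let $n\ge2$, let $\Omega\subseteq\mathbb{R}^n$ be open, and let $w\in L^1(\Omega)$ be a function with the property that there exist $\sigma\in(0,1)$, $c_1\ge1$ and a Radon measure $\mu$ such that, whenever $B_R\subseteq\Omega$ is a ball with radius $R$ and $k\ge0$, the inequality $$[(|w|-k)_+]_{\sigma,1;B_{R/2}}\le\frac{c_1}{R^\sigma}\int_{B_R}(|w|-k)_+\,dx+\frac{c_1\,R\,|\mu|(B_R)}{R^\sigma}$$ holds. Then the estimate $$|w(x_0)|\le\frac{c}{|B(x_0,R)|}\int_{B(x_0,R)}|w|\,dx+c\,\mathbf{I}^{|\mu|}_1(x_0,2R)$$ holds whenever $B(x_0,2R)\subset\Omega$, where the constant $c$ depends on $c_1,n,\sigma$.
   Context: $B(x_0,\varrho)$ is the open ball with center $x_0$ and radius $\varrho$; $B_{R/2}$ is the ball concentric with $B_R$ with radius $R/2$; $(v-k)_+:=\max\{v-k,0\}$; $|\mu|$ is the total variation of the (possibly signed) measure $\mu$. The Gagliardo seminorm on a bounded open set $A$ is $$[v]_{\sigma,1;A}:=\int_A\int_A\frac{|v(x)-v(y)|}{|x-y|^{n+\sigma}}\,dx\,dy,$$ and the truncated Riesz potential is $$\mathbf{I}^{|\mu|}_1(x_0,R):=\int_0^R\frac{|\mu|(B(x_0,\varrho))}{\varrho^{n-1}}\,\frac{d\varrho}{\varrho}.$$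
   Formalization: The estimate is stated at points x_0 where w(x_0) is the limit of the averages of w over B(x_0,ρ) as ρ→0 (in particular at every Lebesgue point); for an arbitrary representative of w∈L^1 it fails, e.g. w=1 at x_0 only, μ=0. *)

(* Defs.v *)
From HB Require Import structures.
From mathcomp Require Import all_boot all_order all_algebra.
From mathcomp Require Import all_classical all_reals all_analysis.

Set Implicit Arguments.
Unset Strict Implicit.
Unset Printing Implicit Defensive.

Import Order.TTheory GRing.Theory Num.Theory.
Import numFieldNormedType.Exports.

Local Open Scope classical_set_scope.
Local Open Scope ring_scope.

(* R^n is 'rV[R]_n. Its library topology is the usual one, but its library norm
   (and hence [ball]) is the sup norm, so the Euclidean norm and balls are
   defined here. *)
Section euclidean.
Context {R : realType} {n : nat}.
Implicit Types x y : 'rV[R]_n.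

Definition enorm x : R := Num.sqrt (\sum_(i < n) x ord0 i ^+ 2).

Definition eball x (r : R) : set 'rV[R]_n := [set y | enorm (y - x) < r].

End euclidean.

(* The sigma-algebra on R^n is the one generated by the coordinates, as the
   library does for n.-tuple; it is the Borel sigma-algebra, see
   [open_measurable_rV]. *)
Section measurable_rV.
Context {R : realType} {n : nat}.

Let coord (i : 'I_n) (x : 'rV[R]_n) : R := x ord0 i.

Let rV_set0 : g_sigma_preimage coord set0.
Proof. exact: sigma_algebra0. Qed.

Let rV_setC A : g_sigma_preimage coord A -> g_sigma_preimage coord (~` A).
Proof. exact: sigma_algebraC. Qed.

Let rV_bigcup (F : (set 'rV[R]_n)^nat) :
  (forall i, g_sigma_preimage coord (F i)) ->
  g_sigma_preimage coord (\bigcup_i (F i)).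
Proof. exact: sigma_algebra_bigcup. Qed.

HB.instance Definition _ :=
  @isMeasurable.Build (measure_tuple_display default_measure_display)
    'rV[R]_n (g_sigma_preimage coord) rV_set0 rV_setC rV_bigcup.

Lemma measurable_coord (i : 'I_n) :
  measurable_fun [set: 'rV[R]_n] (fun x : 'rV[R]_n => x ord0 i).
Proof.
move=> _ Y mY; rewrite setTI; apply: sub_sigma_algebra => /=.
rewrite -bigcup_seq/=; exists i => /=; first by rewrite mem_index_enum.
by exists Y => //; rewrite setTI.
Qed.

Lemma measurable_fun_rV d (T : measurableType d) (f : T -> 'rV[R]_n) :
  (forall i, measurable_fun [set: T] (fun t => f t ord0 i)) ->
  measurable_fun [set: T] f.
Proof.
move=> mf _ A mA.
suff: g_sigma_preimage coord `<=` image_set_system setT f measurable by exact.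
apply: smallest_sub.
  exact/sigma_algebra_image/sigma_algebra_measurable.
rewrite -bigcup_seq; apply: bigcup_sub => i _ B [C mC <-].
by rewrite /image_set_system/= setTI; exact: (mf i).
Qed.

Lemma open_measurable_rV (A : set 'rV[R]_n) : open A -> measurable A.
Proof.
move=> oA.
pose box (q : 'rV[rat]_n * 'rV[rat]_n) : set 'rV[R]_n :=
  [set x | forall i, ratr (q.1 ord0 i) < x ord0 i < ratr (q.2 ord0 i)].
have mbox q : measurable (box q).
  rewrite (_ : box q = \big[setI/setT]_(i < n)
      (coord i @^-1` `]ratr (q.1 ord0 i), ratr (q.2 ord0 i)[)); last first.
    rewrite -bigcap_seq; apply/seteqP; split => x /= xq i => [_|].
      by rewrite /= in_itv/= xq.
    by have := xq i (mem_index_enum i); rewrite /= in_itv.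
  apply: bigsetI_measurable => i _; rewrite -[X in measurable X]setTI.
  exact: measurable_coord.
rewrite (_ : A = \bigcup_q (if `[< box q `<=` A >] then box q else set0)).
  apply: countable_bigcupT_measurable => [|q]; first exact: countableP.
  by case: ifP.
apply/seteqP; split => [x Ax|x [q _]]; last by case: asboolP => // /[apply].
have /nbhs_ballP[e/= e0 xeA] : nbhs x A by exact: open_nbhs_nbhs.
have exq (i : 'I_n) : exists p : rat * rat,
    [/\ x ord0 i - e < ratr p.1, ratr p.1 < x ord0 i, x ord0 i < ratr p.2 &
        ratr p.2 < x ord0 i + e].
  have /rat_in_itvoo[a] : x ord0 i - e < x ord0 i by rewrite ltrBlDr ltrDl.
  have /rat_in_itvoo[b] : x ord0 i < x ord0 i + e by rewrite ltrDl.
  by rewrite !in_itv/= => /andP[? ?] /andP[? ?]; exists (a, b).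
pose p i := projT1 (cid (exq i)).
pose q : 'rV[rat]_n * 'rV[rat]_n := (\row_i (p i).1, \row_i (p i).2).
exists q => //; rewrite asboolT; last first.
  move=> y yq; apply: xeA; split=> // k i; rewrite (ord1 k) /ball/= ltr_distlC.
  have := yq i; rewrite !mxE /p; case: cid => -[a b] /= [xa _ _ xb] /andP[ay yb].
  by rewrite (lt_trans xa ay) (lt_trans yb xb).
by move=> i; rewrite !mxE /p; case: cid => -[a b] /= [_ -> -> _].
Qed.

End measurable_rV.

(* Lebesgue measure on R^n, by iterated products: R^0 carries the unit mass on
   its only point, and R^(n+1) the image of the product of the Lebesgue
   measures of R and R^n. See [lebesgue_rV_box]. *)
Section rV_cons.
Context {R : realType} {n : nat}.

Definition rV_cons (p : measurableTypeR R * 'rV[R]_n) : 'rV[R]_n.+1 :=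
  \row_i (if unlift ord0 i is Some j then p.2 ord0 j else p.1).

Definition rV_uncons (x : 'rV[R]_n.+1) : measurableTypeR R * 'rV[R]_n :=
  (x ord0 ord0, \row_j x ord0 (lift ord0 j)).

Lemma rV_consK : cancel rV_cons rV_uncons.
Proof.
move=> [a v]; rewrite /rV_uncons mxE unlift_none; congr pair.
by apply/rowP => j; rewrite !mxE liftK.
Qed.

Lemma rV_unconsK : cancel rV_uncons rV_cons.
Proof.
move=> x; apply/rowP => i; rewrite mxE.
by case: unliftP => [j ->|->] //=; rewrite mxE.
Qed.

Lemma measurable_rV_cons : measurable_fun [set: measurableTypeR R * 'rV[R]_n] rV_cons.
Proof.
apply: measurable_fun_rV => i.
rewrite (_ : (fun _ => _) = (fun p : measurableTypeR R * 'rV[R]_n =>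
    if unlift ord0 i is Some j then p.2 ord0 j else p.1)); last first.
  by apply/funext => p; rewrite mxE.
case: (unlift ord0 i) => [j|]; last exact: measurable_fst.
exact: (measurableT_comp (measurable_coord j) measurable_snd).
Qed.

Lemma measurable_rV_uncons : measurable_fun [set: 'rV[R]_n.+1] rV_uncons.
Proof.
apply/measurable_fun_pairP; split; first exact: measurable_coord.
apply: measurable_fun_rV => j.
rewrite (_ : (fun _ => _) = (fun x : 'rV[R]_n.+1 => x ord0 (lift ord0 j))).
  exact: measurable_coord.
by apply/funext => x; rewrite mxE.
Qed.

Local Open Scope ereal_scope.

Definition lebesgue_rV_step (m : {sigma_finite_measure set 'rV[R]_n -> \bar R})
    : set 'rV[R]_n.+1 -> \bar R :=
  pushforward (@lebesgue_measure R \x m) rV_cons.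

Variable m : {sigma_finite_measure set 'rV[R]_n -> \bar R}.

Let step0 : lebesgue_rV_step m set0 = 0.
Proof. by rewrite /lebesgue_rV_step /pushforward preimage_set0 measure0. Qed.

Let step_ge0 A : 0 <= lebesgue_rV_step m A.
Proof. by rewrite /lebesgue_rV_step /pushforward; exact: measure_ge0. Qed.

Let step_sigma_additive : semi_sigma_additive (lebesgue_rV_step m).
Proof.
have mcons A : measurable A -> measurable (rV_cons @^-1` A).
  by move=> mA; rewrite -[X in measurable X]setTI; exact: measurable_rV_cons.
move=> F mF tF mUF; rewrite /lebesgue_rV_step /pushforward preimage_bigcup.
apply: measure_semi_sigma_additive; [by move=> i; exact: mcons| |].
- apply/trivIsetP => i j _ _ ij; rewrite -preimage_setI.
  by move/trivIsetP : tF => /(_ _ _ _ _ ij) ->//; rewrite preimage_set0.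
- by rewrite -preimage_bigcup; exact: mcons.
Qed.

HB.instance Definition _ := isMeasure.Build _ _ _
  (lebesgue_rV_step m) step0 step_ge0 step_sigma_additive.

Let step_sigma_finite : sigma_finite setT (lebesgue_rV_step m).
Proof.
have /sigma_finiteP[F [FT ndF Foo]] := sigma_finiteT (@lebesgue_measure R).
have /sigma_finiteP[G [GT ndG Goo]] := sigma_finiteT m.
exists (fun i => rV_uncons @^-1` (F i `*` G i)).
  rewrite -preimage_bigcup -[LHS](preimage_setT rV_uncons); congr (_ @^-1` _).
  apply/seteqP; split => // -[x y] _.
  have [[i _ Fx] [j _ Gy]] : (\bigcup_i F i) x /\ (\bigcup_i G i) y.
    by rewrite -FT -GT.
  exists (maxn i j) => //; split => /=.
    by move: x Fx; exact/subsetPset/ndF/leq_maxl.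
  by move: y Gy; exact/subsetPset/ndG/leq_maxr.
move=> i; have [mF Fi] := Foo i; have [mG Gi] := Goo i; split.
  rewrite -[X in measurable X]setTI; apply: measurable_rV_uncons => //.
  exact: measurableX.
rewrite /lebesgue_rV_step /pushforward (_ : _ @^-1` _ = F i `*` G i).
  by rewrite product_measure1E// lte_mul_pinfty// ge0_fin_numE.
rewrite -comp_preimage (_ : rV_uncons \o rV_cons = id) ?preimage_id//.
by apply/funext => p; exact: rV_consK.
Qed.

HB.instance Definition _ := Measure_isSigmaFinite.Build _ _ _
  (lebesgue_rV_step m) step_sigma_finite.

End rV_cons.

Fixpoint lebesgue_rV {R : realType} (n : nat) :
    {sigma_finite_measure set 'rV[R]_n -> \bar R} :=
  match n with
  | 0 => \d_(0 : 'rV[R]_0)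
  | n'.+1 => lebesgue_rV_step (lebesgue_rV n')
  end.

Lemma lebesgue_rV_box (R : realType) (n : nat) (a b : 'rV[R]_n) :
  (forall i, a ord0 i <= b ord0 i) ->
  lebesgue_rV n [set x | forall i, a ord0 i <= x ord0 i <= b ord0 i] =
  (\prod_(i < n) (b ord0 i - a ord0 i))%:E.
Proof.
elim: n a b => [|n IHn] a b ab.
  rewrite big_ord0 /= /dirac/= indicE mem_set// => -[]//.
pose bx n (a b : 'rV[R]_n) :=
  [set x : 'rV[R]_n | forall i, a ord0 i <= x ord0 i <= b ord0 i].
have mbx k (c d : 'rV[R]_k) : measurable (bx k c d).
  rewrite (_ : bx k c d = \big[setI/setT]_(i < k)
      ((fun x : 'rV[R]_k => x ord0 i) @^-1` `[c ord0 i, d ord0 i])).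
    apply: bigsetI_measurable => i _; rewrite -[X in measurable X]setTI.
    exact: measurable_coord.
  rewrite -bigcap_seq; apply/seteqP; split => x /= xq i => [_|].
    by rewrite /= in_itv/= xq.
  by have := xq i (mem_index_enum i); rewrite /= in_itv.
pose a' : 'rV[R]_n := \row_j a ord0 (lift ord0 j).
pose b' : 'rV[R]_n := \row_j b ord0 (lift ord0 j).
rewrite /= /lebesgue_rV_step /pushforward.
rewrite (_ : _ @^-1` _ = `[a ord0 ord0, b ord0 ord0] `*` bx n a' b').
  rewrite product_measure1E//; last exact: mbx.
  rewrite IHn; last by move=> i; rewrite !mxE.
  rewrite [X in (X * _)%E = _](@lebesgue_measure_itv R)/= big_ord_recl lte_fin.
  rewrite (eq_bigr (fun i : 'I_n => b ord0 (lift ord0 i) - a ord0 (lift ord0 i))).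
    case: ltP => [_|ba]; first by rewrite -EFinD -EFinM.
    have -> : a ord0 ord0 = b ord0 ord0 by apply/eqP; rewrite eq_le ab ba.
    by rewrite subrr mul0r mul0e.
  by move=> i _; rewrite !mxE.
apply/seteqP; split => -[t v] /= => [h|[h1 h2] i].
  split; first by have := h ord0; rewrite !mxE unlift_none in_itv.
  by move=> j; have := h (lift ord0 j); rewrite !mxE liftK.
rewrite mxE; case: unliftP => [j ->|->]; last by rewrite in_itv/= in h1.
by have := h2 j; rewrite !mxE.
Qed.

Section fractional_potential.
Context {R : realType} {n : nat}.
Implicit Types (A Omega : set 'rV[R]_n) (w v : 'rV[R]_n -> R)
  (mu : set 'rV[R]_n -> R) (x y : 'rV[R]_n).

Local Notation leb := (lebesgue_rV n).
Local Open Scope ereal_scope.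

(* The integrand is 0 on the diagonal, by the convention x / 0 = 0. *)
Definition gagliardo (sigma : R) v A : \bar R :=
  \int[leb]_(x in A) \int[leb]_(y in A)
    (`|v x - v y| / enorm (x - y) `^ (n%:R + sigma))%R%:E.

Definition mean v A : \bar R := (leb A)^-1 * \int[leb]_(y in A) (v y)%:E.

(* A function in L^1 is an almost-everywhere class; [has_precise_value w x]
   says that the value [w x] is the one singled out by the class, namely the
   limit of the means over shrinking balls. It holds at every Lebesgue point
   of w, hence almost everywhere for a locally integrable w. *)
Definition has_precise_value w x : Prop :=
  mean w (eball x r) @[r --> (0%R : R)^'+] --> (w x)%:E.

(* A signed Radon measure on Omega is a set function defined on the Borel sets
   that are relatively compact in Omega, and which is a finite signed measure on
   the Borel subsets of every compact subset of Omega. Its positive and negative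
   parts may both be infinite on Omega; values of mu on other sets are
   irrelevant. *)
Definition radon_measure Omega mu : Prop :=
  forall K : set 'rV[R]_n, compact K -> K `<=` Omega ->
    exists nu : {charge set 'rV[R]_n -> \bar R},
      forall A, measurable A -> A `<=` K -> nu A = (mu A)%:E.

Definition total_variation Omega mu A : \bar R :=
  ereal_sup [set \sum_(0 <= h <oo) `|mu (E h)|%:E | E in
    [set E : (set 'rV[R]_n)^nat |
      [/\ trivIset setT E,
          forall h, measurable (E h) /\
            exists K, [/\ compact K, K `<=` Omega & E h `<=` K] &
          \bigcup_h E h `<=` A]]].

(* Only balls contained in Omega matter, so |mu| is taken relative to Omega. *)
Definition riesz_potential Omega mu x (r : R) : \bar R :=
  \int[lebesgue_measure]_(rho in `]0%R, r[)
    (total_variation Omega mu (eball x rho) *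
       ((rho ^+ n.-1)^-1 * rho^-1)%R%:E).

Definition level_sets_estimate (sigma c1 : R) Omega w mu : Prop :=
  forall x (r k : R), (0 < r)%R -> eball x r `<=` Omega -> (0 <= k)%R ->
    let v y := Num.max (`|w y| - k)%R 0%R in
    gagliardo sigma v (eball x (r / 2)) <=
      (c1 / r `^ sigma)%R%:E * \int[leb]_(y in eball x r) (v y)%:E +
      (c1 * r / r `^ sigma)%R%:E * total_variation Omega mu (eball x r).

End fractional_potential.

(* Main.v *)
(* Kilpelainen-Maly style iteration. On the balls of radius r_j = r / 2^j around
   x0, choose levels k_0 = 0 and k_(j+1) = k_j + A_j / kappa, where
   A_j = r_j^(-n) \int_(B_j) (|w| - k_j)_+. By Chebyshev's inequality
   (|w| - k_(j+1))_+ vanishes on B_(j+1) off a set of measure at most kappa r_j^n.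
   The interaction between this small set and its complement alone shows that
   the Gagliardo seminorm controls the integral of (|w| - k_(j+1))_+ with a small
   constant (no fractional Sobolev embedding is needed), so that for a suitable
   kappa one gets A_(j+1) <= (A_j + |mu|(B_j) / r_j^(n-1)) / 2. Summing over j,
   all k_j + A_j are bounded by a multiple of A_0 + I(x0, 2r), and so are the
   means of w over B_j, which converge to w(x0). *)
Require Import Defs.
From mathcomp Require Import all_boot all_order all_algebra.
From mathcomp Require Import all_classical all_reals all_analysis.
From mathcomp Require Import measurable_realfun.
From mathcomp Require Import ring lra.
Import Order.TTheory GRing.Theory Num.Theory.
Import numFieldNormedType.Exports.
Local Open Scope classical_set_scope.
Local Open Scope ring_scope.

(** * Integral inequalities for integrands not known to be measurable *)

Section nonmeasurable_integrand.
Context d (T : measurableType d) (R : realType) (mu : {measure set T -> \bar R}).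
Local Open Scope ereal_scope.

(* Unlike the library's [ge0_le_integral], nothing has to be measurable: the
   integral of a nonnegative function is a supremum over simple functions. *)
Lemma ge0_le_integral_nonmeas (D : set T) (f g : T -> \bar R) :
  (forall x, D x -> 0 <= f x) -> (forall x, D x -> f x <= g x) ->
  \int[mu]_(x in D) f x <= \int[mu]_(x in D) g x.
Proof.
move=> f0 fg; rewrite !ge0_integralE//; last first.
  by move=> x Dx; rewrite (le_trans (f0 x Dx))// fg.
apply: le_ereal_sup => _ [h hf <-]; exists h => // x.
apply: (le_trans (hf x)); rewrite /patch; case: ifPn => //.
by rewrite inE; exact: fg.
Qed.

(** By disjointness at most one term of the step function with value [c i] on [F i] is nonzero at a
    given point, so this function lies below [f]. It serves to bound the Riesz potential below by a
    dyadic sum. *)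
Lemma sum_measure_le_integral (D : set T) (f : T -> \bar R) (F : (set T)^nat)
    (c : (\bar R)^nat) (N : nat) :
  measurable D ->
  (forall i, measurable (F i)) -> trivIset setT F -> (forall i, F i `<=` D) ->
  (forall x, D x -> 0 <= f x) -> (forall i, 0 <= c i) ->
  (forall i x, F i x -> c i <= f x) ->
  \sum_(i < N) c i * mu (F i) <= \int[mu]_(x in D) f x.
Proof.
move=> mD mF tF FD f0 c0 cf.
have mg i : measurable_fun D (fun x => c i * (\1_(F i) x)%:E).
  by apply: measurable_funeM; apply/measurable_EFinP; exact: measurable_indic.
have g0 i x : 0 <= c i * (\1_(F i) x)%:E by rewrite mule_ge0// lee_fin.
have <- : \int[mu]_(x in D) \sum_(i < N) c i * (\1_(F i) x)%:E =
    \sum_(i < N) c i * mu (F i).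
  rewrite (ge0_integral_sum mu mD (f := fun (i : 'I_N) x => c i * (\1_(F i) x)%:E))//.
  apply: eq_bigr => i _; rewrite ge0_integralZl//.
    by rewrite integral_indic// (setIidl (FD i)).
  by apply/measurable_EFinP; exact: measurable_indic.
apply: ge0_le_integral_nonmeas => x Dx; first exact: sume_ge0.
have [[i Fix]|nF] := pselect (exists i : 'I_N, F i x).
  rewrite (bigD1 i)//= [X in _ + X]big1 ?adde0.
    by rewrite indicE mem_set// mule1 cf.
  move=> j ji; rewrite indicE memNset ?mule0// => Fjx.
  have /trivIsetP/(_ i j I I) tij := tF.
  have : (F i `&` F j) x by [].
  by rewrite tij// eq_sym; apply: contra ji => /eqP/val_inj ->.
rewrite big1 ?f0// => i _; rewrite indicE memNset ?mule0// => Fix.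
by apply: nF; exists i.
Qed.

End nonmeasurable_integrand.

(** * Euclidean balls, and their volume by comparison with cubes *)

Section euclidean_balls.
Context {R : realType} {n : nat}.
Implicit Types (x y z : 'rV[R]_n) (rho s : R).

Lemma sum_sqr_ge0 x : 0 <= \sum_(i < n) x ord0 i ^+ 2.
Proof. by apply: sumr_ge0 => i _; exact: sqr_ge0. Qed.

Lemma enorm_ge0 x : 0 <= enorm x. Proof. exact: sqrtr_ge0. Qed.

Lemma sqr_enorm x : enorm x ^+ 2 = \sum_(i < n) x ord0 i ^+ 2.
Proof. by rewrite sqr_sqrtr// sum_sqr_ge0. Qed.

Lemma enorm_lt x rho : 0 < rho ->
  (enorm x < rho) = (\sum_(i < n) x ord0 i ^+ 2 < rho ^+ 2).
Proof.
move=> rho0; rewrite -sqr_enorm.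
by rewrite ltr_pXn2r// nnegrE ?enorm_ge0// ltW.
Qed.

Lemma enorm_eq0 x : enorm x = 0 -> x = 0.
Proof.
move=> x0; have /eqP := sqr_enorm x; rewrite x0 expr0n/= eq_sym.
rewrite psumr_eq0; last by move=> i _; exact: sqr_ge0.
move=> /allP h; apply/rowP => i; rewrite mxE; apply/eqP.
by have := h i (mem_index_enum i); rewrite /= sqrf_eq0.
Qed.

Lemma enormZ (t : R) x : enorm (t *: x) = `|t| * enorm x.
Proof.
rewrite /enorm -sqrtr_sqr -sqrtrM ?sqr_ge0//; congr Num.sqrt.
by rewrite mulr_sumr; apply: eq_bigr => i _; rewrite mxE exprMn.
Qed.

Lemma enormN x : enorm (- x) = enorm x.
Proof. by rewrite -scaleN1r enormZ normrN1 mul1r. Qed.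

Lemma coord_le_enorm x i : `|x ord0 i| <= enorm x.
Proof.
rewrite -ler_sqr ?nnegrE ?enorm_ge0// sqr_enorm real_normK ?num_real//.
by rewrite (bigD1 i)//= lerDl sumr_ge0// => j _; exact: sqr_ge0.
Qed.

(* Weighted Young inequality on each coordinate; the weight s / t is the one
   for which the sum of the squares is at most (s + t)^2. *)
Lemma enormD_lt x y s t : enorm x < s -> enorm y < t -> enorm (x + y) < s + t.
Proof.
move=> xs yt.
have s0 : 0 < s by exact: le_lt_trans (enorm_ge0 _) xs.
have t0 : 0 < t by exact: le_lt_trans (enorm_ge0 _) yt.
rewrite enorm_lt ?addr_gt0//; move: xs yt; rewrite !enorm_lt// => xs yt.
apply: (@le_lt_trans _ _ ((1 + t / s) * (\sum_(i < n) x ord0 i ^+ 2) +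
    (1 + s / t) * (\sum_(i < n) y ord0 i ^+ 2))).
  rewrite 2!mulr_sumr -big_split/=; apply: ler_sum => i _; rewrite mxE -subr_ge0.
  set a := x _ _; set b := y _ _.
  rewrite (_ : _ - _ = (t * a - s * b) ^+ 2 / (s * t)); last first.
    by field; rewrite !gt_eqF.
  by rewrite divr_ge0 ?sqr_ge0// mulr_ge0// ltW.
have -> : (s + t) ^+ 2 = (1 + t / s) * s ^+ 2 + (1 + s / t) * t ^+ 2.
  by field; rewrite !gt_eqF.
by apply: ltrD; rewrite ltr_pM2l// addr_gt0// divr_gt0.
Qed.

Lemma subset_eball x s t : s <= t -> eball x s `<=` eball x t.
Proof. by move=> st y /= /lt_le_trans; apply. Qed.

Lemma eball_center_shift x y s t : enorm (y - x) < t ->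
  eball y s `<=` eball x (s + t).
Proof.
move=> yx z /= zy; rewrite /eball /=.
by rewrite -(subrK y z) -addrA; exact: enormD_lt.
Qed.

Lemma measurable_eball x rho : measurable (eball x rho).
Proof.
have [rho0|rho0] := leP rho 0.
  rewrite (_ : eball x rho = set0) // -subset0 => y.
  by rewrite /eball /= ltNge (le_trans rho0) ?enorm_ge0.
rewrite (_ : eball x rho =
    (fun y : 'rV[R]_n => \sum_(i < n) (y ord0 i - x ord0 i) ^+ 2) @^-1`
    `]-oo, rho ^+ 2[); last first.
  apply/funext => y; rewrite /eball /= in_itv/= enorm_lt//.
  by congr (_ < _); apply: eq_bigr => i _; rewrite !mxE.
rewrite -[X in measurable X]setTI.
have : measurable_fun [set: 'rV[R]_n]
    (fun y : 'rV[R]_n => \sum_(i < n) (y ord0 i - x ord0 i) ^+ 2).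
  apply: measurable_sum => i; apply: measurable_funX.
  by apply: measurable_funB => //; exact: measurable_coord.
by apply => //; exact: measurable_itv.
Qed.

Definition cube x (h : R) : set 'rV[R]_n :=
  [set y | forall i, x ord0 i - h <= y ord0 i <= x ord0 i + h].

Lemma measurable_cube x h : measurable (cube x h).
Proof.
rewrite (_ : cube x h = \big[setI/setT]_(i < n)
    ((fun y : 'rV[R]_n => y ord0 i) @^-1` `[x ord0 i - h, x ord0 i + h])).
  apply: bigsetI_measurable => i _; rewrite -[X in measurable X]setTI.
  exact: measurable_coord.
rewrite -bigcap_seq; apply/seteqP; split => y /= yq i => [_|].
  by rewrite /= in_itv/= yq.
by have := yq i (mem_index_enum i); rewrite /= in_itv.
Qed.

Lemma lebesgue_cube x h : 0 <= h ->
  lebesgue_rV n (cube x h) = ((2 * h) ^+ n)%:E.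
Proof.
move=> h0; have <- : [set y : 'rV[R]_n | forall i,
    (x - const_mx h) ord0 i <= y ord0 i <= (x + const_mx h) ord0 i] = cube x h.
  by apply/seteqP; split => y /= yq i; have := yq i; rewrite !mxE.
rewrite lebesgue_rV_box; last first.
  by move=> i; rewrite !mxE lerD2l lerNl (le_trans _ h0)// oppr_le0.
congr EFin; rewrite (eq_bigr (fun=> 2 * h)); last by move=> i _; rewrite !mxE; ring.
by rewrite prodr_const card_ord.
Qed.

Lemma eball_sub_cube x rho : eball x rho `<=` cube x rho.
Proof.
move=> y /= yx i; rewrite -ler_distlC.
have := coord_le_enorm (y - x) i; rewrite !mxE distrC => /le_trans; apply.
exact: ltW.
Qed.

(** On the cube, the [n] squared coordinates of [y - x] sum to at most [rho ^ 2 / n], which is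
    strictly below [rho ^ 2] as [n >= 2]. *)
Lemma cube_sub_eball x rho : (2 <= n)%N -> 0 < rho ->
  cube x (rho / n%:R) `<=` eball x rho.
Proof.
move=> n2 rho0 y /= yx; rewrite /eball /= enorm_lt//.
have n0 : 0 < n%:R :> R by rewrite ltr0n (leq_trans _ n2).
apply: (@le_lt_trans _ _ (\sum_(i < n) (rho / n%:R) ^+ 2)).
  apply: ler_sum => i _; rewrite !mxE -real_normK ?num_real//.
  rewrite ler_pXn2r ?nnegrE// ?divr_ge0//; last exact: ltW.
  by rewrite distrC ler_distlC yx.
rewrite sumr_const card_ord -[X in X < _]mulr_natl exprMn mulrCA.
rewrite gtr_pMr ?exprn_gt0// exprVn expr2 invfM mulrA mulfV ?gt_eqF// mul1r.
by rewrite invf_lt1// ltr1n.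
Qed.

Lemma lebesgue_eball_ge x rho : (2 <= n)%N -> 0 < rho ->
  (((2 / n%:R) ^+ n * rho ^+ n)%:E <= lebesgue_rV n (eball x rho))%E.
Proof.
move=> n2 rho0.
have -> : (2 / n%:R) ^+ n * rho ^+ n = (2 * (rho / n%:R)) ^+ n.
  by rewrite -exprMn mulrAC mulrA.
rewrite -(lebesgue_cube x); last by rewrite divr_ge0// ltW.
apply: le_measure; rewrite ?inE; [exact: measurable_cube|exact: measurable_eball|].
exact: cube_sub_eball.
Qed.

Lemma lebesgue_eball_le x rho : 0 < rho ->
  (lebesgue_rV n (eball x rho) <= ((2 * rho) ^+ n)%:E)%E.
Proof.
move=> rho0; rewrite -(lebesgue_cube x); last exact: ltW.
apply: le_measure; rewrite ?inE; [exact: measurable_eball|exact: measurable_cube|].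
exact: eball_sub_cube.
Qed.

End euclidean_balls.

(** Chebyshev's inequality. It is applied to superlevel sets of [|w|] and to the inner integral of
    the Gagliardo seminorm. *)
Lemma cst_measure_le_integral d (T : measurableType d) (R : realType)
    (mu : {measure set T -> \bar R}) (D F : set T) (f : T -> \bar R) (c : \bar R) :
  measurable F -> F `<=` D -> (0 <= c)%E -> (forall x, D x -> (0 <= f x)%E) ->
  (forall x, F x -> (c <= f x)%E) ->
  (c * mu F <= \int[mu]_(x in D) f x)%E.
Proof.
move=> mF FD c0 f0 cf; rewrite -integral_cst// integral_mkcond.
rewrite [leRHS]integral_mkcond; apply: ge0_le_integral_nonmeas => x _.
  by rewrite /patch; case: ifP.
rewrite /patch; case: ifPn => [/set_mem Fx|_].
  by rewrite mem_set; [exact: cf|exact: FD].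
by case: ifPn => // /set_mem; exact: f0.
Qed.

(** * A lower bound for the Gagliardo seminorm *)

Section gagliardo_lower_bound.
Context {R : realType} {n : nat}.
Implicit Types (x y z : 'rV[R]_n) (rho s : R).

(** Moving from [x] towards [x0] by the fraction [t = s / (2 * rho)] gives a center at distance less
    than [s / 2] from [x] and less than [rho - s / 2] from [x0]. Hence a fixed share of the ball
    around [x] stays inside, even for [x] near the boundary. *)
Lemma inner_eball x0 x rho s : 0 < s -> s <= rho -> eball x0 rho x ->
  exists z, eball z (s / 2) `<=` eball x0 rho `&` eball x s.
Proof.
move=> s0 srho; rewrite /eball /= => xx0.
have rho0 : 0 < rho by exact: lt_le_trans srho.
pose t := s / (2 * rho).
have t0 : 0 < t by rewrite divr_gt0// mulr_gt0.
have trho : t * rho = s / 2 by rewrite /t; field; rewrite gt_eqF.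
have t1 : 0 < 1 - t by rewrite -(pmulr_lgt0 _ rho0) mulrBl mul1r trho; lra.
exists (x + t *: (x0 - x)) => y yz; split.
  rewrite (_ : rho = s / 2 + (1 - t) * rho); last by rewrite mulrBl trho; ring.
  apply: eball_center_shift yz.
  rewrite (_ : _ - _ = (1 - t) *: (x - x0)).
    by rewrite enormZ gtr0_norm// ltr_pM2l.
  by apply/rowP => i; rewrite !mxE; ring.
rewrite (splitr s); apply: eball_center_shift yz.
rewrite addrAC subrr add0r enormZ gtr0_norm// -opprB enormN -trho.
by rewrite ltr_pM2l.
Qed.

(* If u vanishes off a set E too small to fill half of the ball of radius s / 2
   around a point near x, then the y outside E at distance at most s from x
   alone contribute u x / s^(n + sigma) times a multiple of s^n. *)
Lemma gagliardo_ge (sigma : R) (u : 'rV[R]_n -> R) (E : set 'rV[R]_n) x0 rho s :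
  (2 <= n)%N -> 0 < sigma -> 0 < s -> s <= rho ->
  measurable E ->
  (lebesgue_rV n E <= ((2 / n%:R) ^+ n * (s / 2) ^+ n / 2)%:E)%E ->
  (forall x, 0 <= u x) -> (forall x, eball x0 rho x -> ~ E x -> u x = 0) ->
  measurable_fun (eball x0 rho) (EFin \o u) ->
  (((2 / n%:R) ^+ n * (s / 2) ^+ n / 2 / s `^ (n%:R + sigma))%:E *
     \int[lebesgue_rV n]_(x in eball x0 rho) (u x)%:E <=
   gagliardo sigma u (eball x0 rho))%E.
Proof.
move=> n2 sigma0 s0 srho mE Es u0 uE mu.
set a := _ * _ / 2 in Es *.
set p := n%:R + sigma.
have p0 : 0 < p by rewrite ltr_wpDl.
have sp0 : 0 < s `^ p by rewrite powR_gt0.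
have a0 : 0 <= a by rewrite !(mulr_ge0, exprn_ge0, invr_ge0)// ltW.
rewrite -ge0_integralZl//; last 3 first.
  exact: measurable_eball.
  by move=> x _; rewrite lee_fin.
  by rewrite lee_fin divr_ge0// ltW.
apply: ge0_le_integral_nonmeas => x Bx.
  by rewrite -EFinM lee_fin mulr_ge0// divr_ge0// ltW.
have K0 y : (0 <= (`|u x - u y| / enorm (x - y) `^ p)%:E)%E.
  by rewrite lee_fin divr_ge0// powR_ge0.
have [ux|/eqP ux] := eqVneq (u x) 0.
  by rewrite {1}ux mule0; apply: integral_ge0 => y _; exact: K0.
have [z zB] := inner_eball _ _ _ _ s0 srho Bx.
have s20 : 0 < s / 2 by rewrite divr_gt0.
pose F := eball z (s / 2) `\` E.
have mF : measurable F by apply: measurableD => //; exact: measurable_eball.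
(* The ball of radius [s / 2] has measure at least [2 * a], and [E] takes away at most [a]. *)
have aF : (a%:E <= lebesgue_rV n F)%E.
  have : (lebesgue_rV n (eball z (s / 2)) <= lebesgue_rV n F + lebesgue_rV n E)%E.
    apply: (@le_trans _ _ (lebesgue_rV n (F `|` E))).
      apply: le_measure; rewrite ?inE; [exact: measurable_eball|exact: measurableU|].
      by move=> y zy; have [Ey|nEy] := pselect (E y); [right|left].
    exact: measureU2.
  move=> /(le_trans (lebesgue_eball_ge _ _ n2 s20)).
  move=> /le_trans => /(_ (lebesgue_rV n F + a%:E)%E); rewrite leeD2l// => /(_ isT).
  rewrite -leeBlDr// -EFinB; apply: le_trans.
  by rewrite lee_fin /a; lra.
apply: (@le_trans _ _ ((u x / s `^ p)%:E * lebesgue_rV n F)%E).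
  rewrite -EFinM (_ : a / s `^ p * u x = u x / s `^ p * a); last by ring.
  rewrite EFinM.
  apply: lee_wpmul2l => //.
  by rewrite lee_fin divr_ge0// ltW.
apply: cst_measure_le_integral => //.
- by move=> y [/zB[]].
- by rewrite lee_fin divr_ge0// ltW.
move=> y [/zB[By xy] nEy].
rewrite lee_fin (uE y By nEy) subr0 ger0_norm//.
apply: ler_wpM2l => //.
(* Off the diagonal the kernel can be bounded below by inverting powers; [x] and [y] differ because
   [u] vanishes at [y] but not at [x]. *)
have exy : 0 < enorm (x - y).
  rewrite lt_neqAle enorm_ge0 andbT eq_sym; apply/eqP => /enorm_eq0/eqP.
  by rewrite subr_eq0 => /eqP exy; apply: ux; apply: uE => //; rewrite exy.
rewrite lef_pV2 ?posrE ?powR_gt0//.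
apply: ge0_ler_powR; rewrite ?nnegrE//; [exact: ltW|exact: ltW|exact: ltW|].
by rewrite -opprB enormN ltW.
Qed.

End gagliardo_lower_bound.

(** Half of each term is absorbed into the sum; this is what makes the levels of the iteration
    bounded. *)
Lemma half_recursion_sum (R : realFieldType) (A m : R^nat) (N : nat) :
  (forall j, 0 <= A j) -> (forall j, A j.+1 <= (A j + m j) / 2) ->
  \sum_(j < N) A j <= 2 * A 0%N + \sum_(j < N) m j.
Proof.
move=> A0 Am.
(* The extra term [2 * A N] makes the induction close: it pays for the next summand and for
   [2 * A N.+1]. *)
suff : \sum_(j < N) A j + 2 * A N <= 2 * A 0%N + \sum_(j < N) m j.
  by apply: le_trans; rewrite lerDl mulr_ge0.
elim: N => [|N ih]; first by rewrite !big_ord0 add0r addr0.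
by rewrite !big_ord_recr/=; have := Am N; lra.
Qed.

(** * Truncations of [|w|] at a level *)

Section level_truncation.
Context {R : realType} {n : nat}.
Implicit Types (w : 'rV[R]_n -> R) (D : set 'rV[R]_n) (k l : R).

(** The same expression as in [level_sets_estimate], so that this hypothesis applies to it by
    conversion. *)
Definition excess w k (y : 'rV[R]_n) : R := Num.max (`|w y| - k) 0.

Lemma excess_ge0 w k y : 0 <= excess w k y.
Proof. by rewrite le_max lexx orbT. Qed.

Lemma le_excess w k l y : k <= l -> excess w l y <= excess w k y.
Proof.
move=> kl; rewrite /excess ge_max !le_max lexx orbT andbT.
by rewrite lerD2l lerN2 kl.
Qed.

Lemma abs_le_excess w k y : `|w y| <= k + excess w k y.
Proof. by rewrite -lerBlDl le_max lexx. Qed.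

Lemma excess_le_abs w k y : 0 <= k -> excess w k y <= `|w y|.
Proof. by move=> k0; rewrite ge_max normr_ge0 andbT gerBl. Qed.

Lemma excess_above w k l y : l < `|w y| -> l - k <= excess w k y.
Proof. by move=> /ltW lw; rewrite le_max lerD2r lw. Qed.

Lemma excess_below w k y : `|w y| <= k -> excess w k y = 0.
Proof. by move=> wk; apply: max_r; rewrite subr_le0. Qed.

Lemma measurable_excess w k D :
  measurable_fun D w -> measurable_fun D (excess w k).
Proof.
move=> mw; apply: measurable_maxr => //; apply: measurable_funB => //.
exact: measurableT_comp.
Qed.

Lemma measurable_EFin_excess w k D :
  measurable_fun D w -> measurable_fun D (EFin \o excess w k).
Proof. by move=> mw; apply/measurable_EFinP; exact: measurable_excess. Qed.

End level_truncation.

(** * Total variation and the Riesz potential *)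

(* Unqualified, [total_variation] is the library's variation of a function. *)
Section total_variation_theory.
Context {R : realType} {n : nat}.
Implicit Types (Omega A B : set 'rV[R]_n) (mu : set 'rV[R]_n -> R).

Lemma total_variation_set_ge0 Omega mu A : (0 <= Defs.total_variation Omega mu A)%E.
Proof.
apply: (@le_trans _ _ (\sum_(0 <= h <oo) `|mu set0|%:E)%E).
  by apply: nneseries_ge0 => h _ _; rewrite lee_fin.
apply: ereal_sup_ubound; exists (fun=> set0) => //; split.
- by move=> i j _ _ [y []].
- by move=> h; split => //; exists set0; split => //; exact: compact0.
- by move=> y [].
Qed.

Lemma le_total_variation_set Omega mu A B : A `<=` B ->
  (Defs.total_variation Omega mu A <= Defs.total_variation Omega mu B)%E.
Proof.
move=> AB; apply: ereal_sup_le => _ [E [tE EK EA] <-]; exists E => //; split=> //.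
exact: subset_trans AB.
Qed.

(** With [rho j = r / 2 ^ j], the integrand of the potential on [[rho j, 2 * rho j[] is at least the
    variation of the ball of radius [rho j] times [(2 * rho j) ^ (- n)]. Multiplying by the length
    [rho j] gives the summand. The interval for [j = 0] ends at [2 * r], whence the radius of the
    potential. *)
Lemma dyadic_sum_le_riesz_potential Omega mu x (r : R) N : 0 < r -> (0 < n)%N ->
  (\sum_(j < N) Defs.total_variation Omega mu (eball x (r / 2 ^+ j)) *
      ((2 ^+ n)^-1 * ((r / 2 ^+ j) ^+ n.-1)^-1)%:E <=
    riesz_potential Omega mu x (2 * r))%E.
Proof.
move=> r0 n0.
pose rho j := r / 2 ^+ j.
have rho0 j : 0 < rho j by rewrite divr_gt0// exprn_gt0.
have rhoS j : 2 * rho j.+1 = rho j.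
  by rewrite /rho exprS invfM mulrCA mulVKf// pnatr_eq0.
have rho_le i j : (i <= j)%N -> rho j <= rho i.
  move=> ij; rewrite ler_pM2l// lef_pV2 ?posrE ?exprn_gt0//.
  by rewrite ler_eXn2l// ltr1n.
pose F j : set R := `[rho j, 2 * rho j[%classic.
pose c j : \bar R := (Defs.total_variation Omega mu (eball x (rho j)) *
  (((2 * rho j) ^+ n.-1)^-1 * (2 * rho j)^-1)%:E)%E.
have F_disj i j y : (i < j)%N -> F i y -> F j y -> False.
  move=> ij; rewrite /F /= !in_itv/= => /andP[iy _] /andP[_].
  case: j ij => // j; rewrite ltnS rhoS => /rho_le ij.
  by rewrite ltNge (le_trans ij iy).
have -> : (\sum_(j < N) Defs.total_variation Omega mu (eball x (r / 2 ^+ j)) *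
      ((2 ^+ n)^-1 * ((r / 2 ^+ j) ^+ n.-1)^-1)%:E =
    \sum_(j < N) c j * @lebesgue_measure R (F j))%E.
  apply: eq_bigr => j _; rewrite (_ : r / 2 ^+ j = rho j)// /F.
  rewrite lebesgue_measure_itv/= lte_fin.
  rewrite ltr_pMl// ltr1n/= /c -muleA -EFinB -EFinM; congr (_ * _%:E)%E.
  rewrite -[in 2 ^+ n](prednK n0) exprS [(2 * rho j) ^+ _]exprMn.
  by field; rewrite !expf_neq0 ?pnatr_eq0// gt_eqF// rho0.
apply: (@sum_measure_le_integral _ (measurableTypeR R) R
  lebesgue_measure _ _ F) => //.
- by move=> i; exact: measurable_itv.
- apply/trivIsetP => i j _ _ ij; apply/seteqP; split => // y [Fi Fj].
  by move: ij; rewrite neq_ltn => /orP[ij|ji];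
    [exact: F_disj ij Fi Fj|exact: F_disj ji Fj Fi].
- move=> j y; rewrite /F /= !in_itv/= => /andP[jy yj].
  rewrite (lt_le_trans (rho0 j) jy)/= (lt_le_trans yj)// ler_pM2l//.
  by rewrite (le_trans (rho_le 0%N j _))// /rho expr0 divr1.
- move=> y; rewrite /= in_itv/= => /andP[y0 _].
  rewrite mule_ge0 ?total_variation_set_ge0// lee_fin.
  by rewrite mulr_ge0// invr_ge0 ?exprn_ge0// ltW.
- move=> j; rewrite mule_ge0 ?total_variation_set_ge0// lee_fin.
  by rewrite mulr_ge0// invr_ge0 ?exprn_ge0// mulr_ge0// ltW.
move=> j y; rewrite /F /= in_itv/= => /andP[jy yj].
have y0 : 0 < y := lt_le_trans (rho0 j) jy.
apply: lee_pmul; rewrite ?total_variation_set_ge0//.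
- by rewrite lee_fin mulr_ge0// invr_ge0 ?exprn_ge0// mulr_ge0// ltW.
- by apply: le_total_variation_set; exact: subset_eball.
rewrite lee_fin; apply: ler_pM; rewrite ?invr_ge0 ?exprn_ge0// ?mulr_ge0//;
  try exact: ltW; rewrite lef_pV2 ?posrE ?exprn_gt0 ?mulr_gt0//; last exact: ltW.
by apply: lerXn2r; rewrite ?nnegrE ?mulr_ge0//; exact: ltW.
Qed.

End total_variation_theory.

(** * Decay of the excess from a ball to its half, and means over balls *)

Section excess_on_balls.
Context {R : realType} {n : nat}.
Hypothesis n2 : (2 <= n)%N.
Implicit Types (w : 'rV[R]_n -> R) (x : 'rV[R]_n) (k l rho : R).

Local Notation leb := (lebesgue_rV n).
Local Notation a := ((2 / n%:R) ^+ n).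

Let a0 : 0 < a :> R.
Proof. by rewrite exprn_gt0// divr_gt0// ltr0n (leq_trans _ n2). Qed.

Lemma integral_excess_ge0 w k (D : set 'rV[R]_n) :
  (0 <= \int[leb]_(y in D) (excess w k y)%:E)%E.
Proof. by apply: integral_ge0 => y _; rewrite lee_fin excess_ge0. Qed.

Lemma integral_excess_fin w k (D : set 'rV[R]_n) : measurable D -> 0 <= k ->
  leb.-integrable D (EFin \o w) ->
  (\int[leb]_(y in D) (excess w k y)%:E)%E \is a fin_num.
Proof.
move=> mD k0 /integrableP[_ wfin].
rewrite ge0_fin_numE ?integral_excess_ge0//; apply: le_lt_trans wfin.
apply: ge0_le_integral_nonmeas => y _; rewrite lee_fin; first exact: excess_ge0.
exact: excess_le_abs.
Qed.

(* At level l > k only a small part of the ball is left, by Chebyshev's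
   inequality, so [gagliardo_ge] makes the seminorm bounded by hypothesis control
   the excess over l with a factor as small as desired. *)
Lemma excess_decay (sigma c1 delta : R) (Omega : set 'rV[R]_n) w
    (mu : set 'rV[R]_n -> R) x rho k l :
  0 < sigma -> 0 < delta -> delta <= 2^-1 -> 0 < c1 ->
  4 ^+ n.+1 * c1 * delta `^ sigma <= a ->
  level_sets_estimate sigma c1 Omega w mu ->
  0 < rho -> eball x rho `<=` Omega ->
  measurable_fun (eball x rho) w -> 0 <= k -> k <= l ->
  (\int[leb]_(y in eball x rho) (excess w k y)%:E <=
    ((l - k) * (a * (delta / 2) ^+ n / 2 * rho ^+ n))%:E)%E ->
  (\int[leb]_(y in eball x (rho / 2)) (excess w l y)%:E <=
    ((2 ^+ n.+1)^-1)%:E * (\int[leb]_(y in eball x rho) (excess w k y)%:E +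
      rho%:E * Defs.total_variation Omega mu (eball x rho)))%E.
Proof.
move=> sigma0 delta0 delta_half c10 delta_sigma Hw rho0 BO mw k0 kl kV.
have half_sub : eball x (rho / 2) `<=` eball x rho.
  by apply: subset_eball; rewrite ler_pdivrMr// ler_pMr// ler1n.
have mB := measurable_eball x rho.
have mB2 := measurable_eball x (rho / 2).
have TV0 := total_variation_set_ge0 Omega mu (eball x rho).
have V_mono : (\int[leb]_(y in eball x rho) (excess w l y)%:E <=
    \int[leb]_(y in eball x rho) (excess w k y)%:E)%E.
  apply: ge0_le_integral_nonmeas => y _; rewrite lee_fin ?excess_ge0//.
  exact: le_excess.
have rT0 : (0 <= rho%:E * Defs.total_variation Omega mu (eball x rho))%E.
  by rewrite mule_ge0// lee_fin ltW.
have rhs0 : (0 <= \int[leb]_(y in eball x rho) (excess w k y)%:E +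
    rho%:E * Defs.total_variation Omega mu (eball x rho))%E.
  by rewrite adde_ge0 ?integral_excess_ge0.
(* Chebyshev's inequality needs [k < l]. If [k = l], the smallness assumption already forces the
   excess to have zero integral. *)
move: kl; rewrite le_eqVlt => /predU1P[kl|kl].
  apply: (@le_trans _ _ 0%E); last first.
    by rewrite mule_ge0// lee_fin invr_ge0 exprn_ge0.
  move: kV; rewrite -kl subrr mul0r; apply: le_trans.
  apply: ge0_subset_integral => //; first exact: measurable_EFin_excess.
  by move=> y _; rewrite lee_fin excess_ge0.
pose E := eball x (rho / 2) `&` (fun y => `|w y|) @^-1` `]l, +oo[.
have mw2 : measurable_fun (eball x (rho / 2)) w by exact: measurable_funS mw.
have mE : measurable E.
  have : measurable_fun (eball x (rho / 2)) (fun y => `|w y|).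
    exact: measurableT_comp.
  by apply => //; exact: measurable_itv.
(* The interaction distance: [delta <= 1/2] makes it at most the radius [rho / 2], and a small
   [delta] makes the kernel strong. *)
pose s := delta * rho.
have s0 : 0 < s by rewrite mulr_gt0.
have lebE : (leb E <= (a * (s / 2) ^+ n / 2)%:E)%E.
  have : ((l - k)%:E * leb E <= \int[leb]_(y in eball x rho) (excess w k y)%:E)%E.
    apply: cst_measure_le_integral => //.
    - by move=> y [/half_sub].
    - by rewrite lee_fin subr_ge0 ltW.
    - by move=> y _; rewrite lee_fin excess_ge0.
    - move=> y [_]; rewrite /= in_itv/= andbT => ly.
      by rewrite lee_fin excess_above.
  move=> /le_trans /(_ kV); rewrite EFinM lee_pmul2l ?lte_fin ?subr_gt0//.
  rewrite (_ : a * (s / 2) ^+ n / 2 = a * (delta / 2) ^+ n / 2 * rho ^+ n)//.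
  by rewrite (_ : s / 2 = delta / 2 * rho) ?exprMn /s; ring.
have := gagliardo_ge sigma (excess w l) E x (rho / 2) s n2 sigma0 s0.
have s_half : s <= rho / 2 by rewrite /s mulrC ler_pM2l.
move=> /(_ s_half mE lebE (excess_ge0 w l)).
have E_above y : eball x (rho / 2) y -> ~ E y -> excess w l y = 0.
  move=> By nEy; apply: excess_below; rewrite leNgt; apply/negP => ly.
  by apply: nEy; split => //; rewrite /= in_itv/= ly.
move=> /(_ E_above (measurable_EFin_excess _ _ _ mw2)).
have l0 : 0 <= l by rewrite (le_trans k0)// ltW.
move=> /le_trans /(_ (Hw x rho l rho0 BO l0)).
have rs0 : 0 < rho `^ sigma by rewrite powR_gt0.
have ds0 : 0 < delta `^ sigma by rewrite powR_gt0.
set X := (\int[leb]_(y in eball x (rho / 2)) _)%E.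
set V := (\int[leb]_(y in eball x rho) (excess w k y)%:E)%E in V_mono rhs0 *.
set T := Defs.total_variation _ _ _ in TV0 rT0 rhs0 *.
set C := _ / s `^ _ => CX.
(* The factor [s ^ n] of the volume cancels against the kernel, leaving only [s ^ (- sigma)]. *)
have CE : C = a / 2 ^+ n.+1 / (delta `^ sigma * rho `^ sigma).
  rewrite /C powRD; last by rewrite (gt_eqF s0) implybT.
  rewrite powR_mulrn ?(ltW s0)// -powRM ?(ltW delta0) ?(ltW rho0)// -/s.
  rewrite [(s / 2) ^+ _]expr_div_n exprS.
  by field; rewrite !expf_neq0 ?pnatr_eq0 ?gt_eqF// powR_gt0.
have C0 : 0 < C.
  by rewrite CE; apply: divr_gt0; [rewrite divr_gt0// exprn_gt0|exact: mulr_gt0].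
rewrite -(lee_pmul2l (x := C%:E)) ?lte_fin//.
apply: (le_trans CX); rewrite muleA -EFinM.
apply: (@le_trans _ _ ((c1 / rho `^ sigma)%:E * (V + rho%:E * T))%E).
  rewrite [leRHS]ge0_muleDr ?rT0 ?integral_excess_ge0//.
  rewrite muleA -EFinM [c1 / _ * rho]mulrAC leeD2r//.
  by apply: lee_wpmul2l => //; rewrite lee_fin divr_ge0// ltW.
apply: lee_wpmul2r => //; rewrite lee_fin CE.
rewrite -mulrA -invfM -mulrA -invfM ler_pdivlMr ?mulr_gt0 ?exprn_gt0//.
(* The constant [4 ^ n.+1] is the product of the [2 ^ n.+1] in [C] and the [2 ^ n.+1] in the desired
   decay factor. *)
apply: le_trans delta_sigma.
rewrite (_ : (4 : R) = 2 * 2); last by ring.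
rewrite exprMn le_eqVlt; apply/orP; left; apply/eqP.
by field; rewrite gt_eqF.
Qed.

(** Averaging [|w| <= k + excess w k] and bounding the volume of the ball below by [a * rho ^ n].
    The upper volume bound only rules out infinite volume. *)
Lemma abse_mean_le w x rho k v : 0 < rho -> 0 <= k ->
  leb.-integrable (eball x rho) (EFin \o w) ->
  (\int[leb]_(y in eball x rho) (excess w k y)%:E)%E = v%:E ->
  (`|mean w (eball x rho)| <= (k + v / (a * rho ^+ n))%:E)%E.
Proof.
move=> rho0 k0 wi kv.
have mB := measurable_eball x rho.
have v0 : 0 <= v by rewrite -lee_fin -kv integral_excess_ge0.
have := lebesgue_eball_ge x rho n2 rho0; have := lebesgue_eball_le x rho rho0.
rewrite /mean; case lebB : (leb (eball x rho)) => [b| |]//.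
rewrite !lee_fin => _ ab.
have arho0 : 0 < a * rho ^+ n by rewrite mulr_gt0// exprn_gt0.
have b0 : 0 < b by exact: lt_le_trans ab.
have mw : measurable_fun (eball x rho) w.
  by apply/measurable_EFinP; case/integrableP : wi.
rewrite inver gt_eqF// abseM gee0_abs ?lee_fin ?invr_ge0 ?(ltW b0)//.
apply: (@le_trans _ _ ((b^-1)%:E * (k * b + v)%:E)%E); last first.
  rewrite -EFinM lee_fin mulrDr mulrCA mulVf ?gt_eqF// mulr1 lerD2l mulrC.
  by apply: ler_wpM2l => //; rewrite lef_pV2.
apply: lee_wpmul2l; first by rewrite lee_fin invr_ge0 ltW.
apply: (le_trans (le_abse_integral _ _ _)) => //; first exact/measurable_EFinP.
rewrite EFinD EFinM -lebB -kv -integral_cst// -ge0_integralD//.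
- apply: ge0_le_integral_nonmeas => y _ /=; rewrite lee_fin//; exact: abs_le_excess.
- by move=> y _; rewrite lee_fin excess_ge0.
- exact: measurable_EFin_excess.
Qed.

End excess_on_balls.

(** * The iteration over dyadic balls *)

Section pointwise_bound.
Context {R : realType} {n : nat}.
Hypothesis n2 : (2 <= n)%N.
Implicit Types (w : 'rV[R]_n -> R) (x : 'rV[R]_n).

Local Notation leb := (lebesgue_rV n).
Local Notation a := ((2 / n%:R) ^+ n).

Let a0 : 0 < a :> R.
Proof. by rewrite exprn_gt0// divr_gt0// ltr0n (leq_trans _ n2). Qed.

Lemma precise_value_le w x (r C : R) : 0 < r -> has_precise_value w x ->
  (forall j, (`|mean w (eball x (r / 2 ^+ j))| <= C%:E)%E) -> `|w x| <= C.
Proof.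
move=> r0 wx wC.
have rj0 j : 0 < r / 2 ^+ j by rewrite divr_gt0// exprn_gt0.
have cvg0 : (r / 2 ^+ j) @[j --> \oo] --> (0 : R).
  rewrite -[X in _ --> X](mulr0 r).
  under eq_fun do rewrite -exprVn.
  apply: cvgM; first exact: cvg_cst.
  by apply: cvg_expr; rewrite ger0_norm ?invr_ge0// invf_lt1// ltr1n.
(* The precise value is a limit over radii tending to 0 from the right, so positivity of the dyadic
   radii has to be added to their convergence. *)
have cvg_right : (r / 2 ^+ j) @[j --> \oo] --> (0 : R)^'+.
  move=> A /cvg0 A0; change (\forall j \near \oo, A (r / 2 ^+ j)).
  have : \forall j \near \oo, 0 < r / 2 ^+ j -> A (r / 2 ^+ j) by exact: A0.
  by apply: filterS => j; apply.
have : (`|mean w (eball x (r / 2 ^+ j))|)%E @[j --> \oo] --> `|(w x)%:E|%E.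
  exact: cvg_abse (cvg_comp _ _ cvg_right wx).
rewrite -lee_fin; apply: cvge_le; exact: nearW.
Qed.

(** The ball lies in a cube of side [2 * r], so its volume is at most [2 ^ n * r ^ n]. *)
Lemma integral_abs_le_mean w x (r : R) : 0 < r ->
  (((r ^+ n)^-1)%:E * \int[leb]_(y in eball x r) (`|w y|)%:E <=
   (2 ^+ n)%:E * mean (fun y => `|w y|%R) (eball x r))%E.
Proof.
move=> r0; have := lebesgue_eball_ge x r n2 r0; have := lebesgue_eball_le x r r0.
rewrite /mean; case: (leb (eball x r)) => [b| |]//; rewrite !lee_fin => br ab.
have rn0 : 0 < r ^+ n by rewrite exprn_gt0.
have b0 : 0 < b by apply: lt_le_trans ab; rewrite mulr_gt0.
rewrite inver gt_eqF// muleA -EFinM; apply: lee_wpmul2r.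
  by apply: integral_ge0 => y _; rewrite lee_fin.
rewrite lee_fin ler_pdivlMr// mulrC ler_pdivrMr//.
by rewrite -exprMn.
Qed.

(** In [c], the first inverse comes from the increments of the levels, [a^-1] from the volume bound
    for the remaining excess, and [2 ^ n.+1] from the factor 2 of the summation and the [2 ^ n]
    relating [A 0] to the mean. *)
Lemma abs_precise_value_le (sigma c1 delta : R) (Omega : set 'rV[R]_n) w
    (mu : set 'rV[R]_n -> R) x r c :
  c = ((a * (delta / 2) ^+ n / 2)^-1 + a^-1) * 2 ^+ n.+1 ->
  0 < sigma -> 0 < delta -> delta <= 2^-1 -> 0 < c1 ->
  4 ^+ n.+1 * c1 * delta `^ sigma <= a ->
  level_sets_estimate sigma c1 Omega w mu ->
  0 < r -> eball x r `<=` Omega ->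
  leb.-integrable (eball x r) (EFin \o w) ->
  has_precise_value w x ->
  (`|w x|%:E <= c%:E * mean (fun y => `|w y|%R) (eball x r) +
     c%:E * riesz_potential Omega mu x (2 * r))%E.
Proof.
set kappa := a * _ / 2 => cE.
move=> sigma0 delta0 delta_half c10 delta_sigma Hw r0 BO wi wx.
have kappa0 : 0 < kappa by rewrite divr_gt0// mulr_gt0// exprn_gt0// divr_gt0.
have ka0 : 0 < kappa^-1 + a^-1 by rewrite addr_gt0 ?invr_gt0.
have c0 : 0 < c by rewrite cE mulr_gt0// exprn_gt0.
pose rho j := r / 2 ^+ j.
have rho0 j : 0 < rho j by rewrite divr_gt0// exprn_gt0.
have rhon0 j : 0 < rho j ^+ n by rewrite exprn_gt0.
have rho_half j : rho j / 2 = rho j.+1.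
  by rewrite /rho exprSr invfM mulrA.
have Bj j : eball x (rho j) `<=` eball x r.
  apply: subset_eball; rewrite ler_pdivrMr ?exprn_gt0// ler_pMr//.
  by rewrite exprn_ege1// ler1n.
have mB j := measurable_eball x (rho j).
have wij j : leb.-integrable (eball x (rho j)) (EFin \o w).
  by apply: integrableS wi => //; exact: measurable_eball.
have mw j : measurable_fun (eball x (rho j)) w.
  by apply/measurable_EFinP; have /integrableP[] := wij j.
pose V j l := fine (\int[leb]_(y in eball x (rho j)) (excess w l y)%:E)%E.
have VE j l : 0 <= l ->
    (\int[leb]_(y in eball x (rho j)) (excess w l y)%:E)%E = (V j l)%:E.
  by move=> l0; rewrite fineK// integral_excess_fin.
have V0 j l : 0 <= V j l by rewrite fine_ge0// integral_excess_ge0.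
have sum_TV N := dyadic_sum_le_riesz_potential Omega mu x r N r0 (ltnW n2).
have pot0 : (0 <= riesz_potential Omega mu x (2 * r))%E.
  by have := sum_TV 0%N; rewrite big_ord0.
have mean0 : (0 <= mean (fun y => `|w y|%R) (eball x r))%E.
  rewrite mule_ge0 ?inve_ge0//.
  by apply: integral_ge0 => y _; rewrite lee_fin.
(* If the potential is infinite, so is the right-hand side. Otherwise it is a real [P], and every
   term of the dyadic sum, hence every [T j], is finite. *)
move: pot0 sum_TV; case: (riesz_potential _ _ _ _) => [P| |]// pot0 sum_TV.
2: {
  rewrite mulry gtr0_sg// mul1e addey ?leey//.
  by rewrite gt_eqF// (@lt_le_trans _ _ 0%E) ?ltNy0// mule_ge0// lee_fin ltW. }
pose T j := Defs.total_variation Omega mu (eball x (rho j)).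
have T0 j : (0 <= T j)%E by exact: total_variation_set_ge0.
pose q j : R := (2 ^+ n)^-1 * (rho j ^+ n.-1)^-1.
have q0 j : 0 < q j by rewrite mulr_gt0// invr_gt0 exprn_gt0.
have Tq0 j : (0 <= T j * (q j)%:E)%E by rewrite mule_ge0// lee_fin ltW.
have Tfin j : T j \is a fin_num.
  have : (T j * (q j)%:E <= P%:E)%E.
    apply: le_trans (sum_TV j.+1); rewrite big_ord_recr/= leeDr//.
    by apply: sume_ge0 => i _; exact: Tq0.
  have := T0 j; case: (T j) => [t| |]//= _.
  by rewrite mulyr gtr0_sg// mul1e leye_eq.
pose m j := fine (T j) * (rho j ^+ n.-1)^-1.
have sum_m N : \sum_(j < N) m j <= 2 ^+ n * P.
  rewrite -ler_pdivrMl ?exprn_gt0// -lee_fin; apply: le_trans (sum_TV N).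
  rewrite mulr_sumr -sumEFin le_eqVlt; apply/orP; left; apply/eqP.
  apply: eq_bigr => j _; rewrite -/(rho j) -/(T j) -[T j]fineK//.
  by rewrite -EFinM /m mulrCA.
pose k := fix f j :=
  if j is i.+1 then f i + V i (f i) / (kappa * rho i ^+ n) else 0.
pose A j := V j (k j) / rho j ^+ n.
have A0 j : 0 <= A j by rewrite divr_ge0// ltW.
have kS j : k j.+1 = k j + A j / kappa.
  by rewrite /= /A invfM mulrA [in RHS]mulrAC.
have kE j : k j = (\sum_(i < j) A i) / kappa.
  elim: j => [|j ih]; first by rewrite big_ord0 mul0r.
  by rewrite kS ih big_ord_recr/= mulrDl.
have k0 j : 0 <= k j by rewrite kE divr_ge0 ?sumr_ge0// ltW.
have decay j : A j.+1 <= (A j + m j) / 2.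
  have := excess_decay n2 sigma c1 delta Omega w mu x (rho j) (k j) (k j.+1)
    sigma0 delta0 delta_half c10 delta_sigma Hw (rho0 j)
    (subset_trans (Bj j) BO) (mw j) (k0 j).
  have kle : k j <= k j.+1 by rewrite kS lerDl divr_ge0// ltW.
  move=> /(_ kle); rewrite rho_half VE// VE// -/(T j) -[T j]fineK//.
  rewrite -(EFinM (rho j)) -EFinD -EFinM !lee_fin -/kappa => H.
  (* The levels are chosen so that this assumption of [excess_decay] holds with equality. *)
  have /H{H} : V j (k j) <= (k j.+1 - k j) * (kappa * rho j ^+ n).
    rewrite kS addrAC subrr add0r /A le_eqVlt; apply/orP; left; apply/eqP.
    by field; rewrite (gt_eqF (rhon0 j)) gt_eqF.
  move=> Vle; rewrite /A ler_pdivrMr//; apply: (le_trans Vle).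
  (* Normalizing by [rho j.+1 ^ n] costs [2 ^ n], so the decay factor [2 ^ (- n.+1)] becomes
     [1 / 2]. *)
  rewrite -rho_half [(rho j / 2) ^+ n]expr_div_n /m.
  rewrite -[in rho j ^+ n](prednK (ltnW n2)) exprS exprS le_eqVlt; apply/orP; left; apply/eqP.
  by field; rewrite !expf_neq0 ?pnatr_eq0// gt_eqF.
have sumA N : \sum_(j < N) A j <= 2 * A 0%N + 2 ^+ n * P.
  by apply: le_trans (half_recursion_sum _ _ _ N A0 decay) _; rewrite lerD2l.
have A0_mean : ((A 0%N)%:E <= (2 ^+ n)%:E * mean (fun y => `|w y|%R) (eball x r))%E.
  apply: le_trans (integral_abs_le_mean w x r r0).
  rewrite /A [k 0%N]/= mulrC EFinM -VE// /rho expr0 divr1.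
  apply: lee_wpmul2l; first by rewrite lee_fin invr_ge0 exprn_ge0// ltW.
  apply: ge0_le_integral_nonmeas => y _; rewrite lee_fin ?excess_ge0//.
  exact: excess_le_abs.
(* The mean over the [j]-th ball is at most [k j + A j / a]; [k j] is a partial sum of [A] over
   [kappa], and [A j] is a single term of such a sum. *)
have bound : `|w x| <= (kappa^-1 + a^-1) * (2 * A 0%N + 2 ^+ n * P).
  apply: (precise_value_le _ _ _ _ r0 wx) => j.
  apply: le_trans (abse_mean_le n2 w x (rho j) (k j) _ (rho0 j) (k0 j)
    (wij j) (VE _ _ (k0 j))) _.
  rewrite lee_fin [leRHS]mulrDl; apply: lerD.
    by rewrite kE mulrC ler_wpM2l// invr_ge0 ltW.
  rewrite invfM mulrCA ler_wpM2l ?invr_ge0 ?(ltW a0)//.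
  apply: le_trans (sumA j.+1); rewrite big_ord_recr/= lerDr.
  exact: sumr_ge0.
apply: (@le_trans _ _ ((kappa^-1 + a^-1) * (2 * A 0%N + 2 ^+ n * P))%:E).
  by rewrite lee_fin.
rewrite mulrDr EFinD; apply: leeD.
  rewrite mulrA EFinM.
  rewrite (_ : c = (kappa^-1 + a^-1) * 2 * 2 ^+ n); last by rewrite cE exprS mulrA.
  rewrite [in leRHS]EFinM -muleA; apply: lee_wpmul2l => //.
  by rewrite lee_fin mulr_ge0// ltW.
rewrite -EFinM lee_fin mulrA ler_wpM2r -?lee_fin// lee_fin.
by rewrite cE ler_wpM2l ?(ltW ka0)// exprS ler_peMl ?exprn_ge0// ler1n.
Qed.

End pointwise_bound.

(** * Choice of [delta] and conclusion *)

Theorem theorem4p2 (R : realType) (n : nat) (hn : (2 <= n)%N)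
    (sigma c1 : R) (sigma0 : 0 < sigma) (sigma1 : sigma < 1) (hc1 : 1 <= c1) :
  exists c : R, 0 < c /\
  forall (Omega : set 'rV[R]_n) (w : 'rV[R]_n -> R) (mu : set 'rV[R]_n -> R),
    open Omega ->
    (lebesgue_rV n).-integrable Omega (EFin \o w) ->
    radon_measure Omega mu ->
    level_sets_estimate sigma c1 Omega w mu ->
    forall (x0 : 'rV[R]_n) (r : R), 0 < r ->
      eball x0 (2 * r) `<=` Omega ->
      has_precise_value w x0 ->
      (`|w x0|%:E <= c%:E * mean (fun y => `|w y|%R) (eball x0 r) +
                     c%:E * riesz_potential Omega mu x0 (2 * r))%E.
Proof.
pose a : R := (2 / n%:R) ^+ n.
have n0 : 0 < n%:R :> R by rewrite ltr0n (leq_trans _ hn).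
have a0 : 0 < a by rewrite exprn_gt0// divr_gt0.
have a1 : a <= 1.
  by rewrite exprn_ile1 ?divr_ge0 ?(ltW n0)// ler_pdivrMr// mul1r ler_nat.
have c10 : 0 < c1 by exact: lt_le_trans hc1.
have d0 : 0 < 4 ^+ n.+1 * c1 by rewrite mulr_gt0// exprn_gt0.
pose q := a / (4 ^+ n.+1 * c1).
have q0 : 0 < q by rewrite divr_gt0.
have q_half : q <= 2^-1.
  have : 4 <= 4 ^+ n.+1 * c1.
    rewrite -[leLHS]mulr1; apply: ler_pM => //.
    by rewrite exprS ler_peMr// exprn_ege1// ler1n.
  by rewrite /q ler_pdivrMr//; move: (_ * c1) => D; lra.
(* This solves [4 ^ n.+1 * c1 * delta ^ sigma = a], so [delta], and with it the final constant,
   depends on [n], [sigma] and [c1] only. *)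
pose delta := q `^ sigma^-1.
have delta0 : 0 < delta by rewrite powR_gt0.
have delta_half : delta <= 2^-1.
  apply: (le_trans _ q_half); rewrite -[leRHS]powRr1 ?(ltW q0)//.
  (* Since [q <= 1] and [sigma < 1], raising [q] to the power [1 / sigma >= 1] does not increase
     it. *)
  apply: ger_powR; first by rewrite q0/= (le_trans q_half)// invf_le1// ler1n.
  by rewrite invf_ge1// ltW.
have delta_sigma : 4 ^+ n.+1 * c1 * delta `^ sigma <= a.
  rewrite /delta -powRrM mulVf ?gt_eqF// powRr1 ?(ltW q0)//.
  by rewrite /q mulrCA mulfV ?mulr1// gt_eqF.
exists (((a * (delta / 2) ^+ n / 2)^-1 + a^-1) * 2 ^+ n.+1); split.
  by rewrite mulr_gt0 ?exprn_gt0// addr_gt0// invr_gt0// divr_gt0// mulr_gt0//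
    exprn_gt0// divr_gt0.
move=> Omega w mu oO wi _ Hw x0 r r0 BO wx.
have BrO : eball x0 r `<=` Omega.
  by apply: subset_trans BO; apply: subset_eball; rewrite ler_peMl ?ler1n// ltW.
apply: (abs_precise_value_le hn sigma c1 delta _ _ _ _ _ _ erefl) => //.
apply: integrableS wi => //; first exact: open_measurable_rV.
exact: measurable_eball.
Qed.
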